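(* For every integer $k\ge 1$, $$\alpha_{2,2k}=k\,2^k.$$ Equivalently, the sequence $(\alpha_{2,2k})_{k\ge 1}$ coincides with the OEIS sequence A036289.
   Context: For integers $n,m\ge 1$, the grid $G(n,m)$ has cell set $V_{n,m}=\{(i,j): 1\le i\le n,\ 1\le j\le m\}$ ($i$ = row, $j$ = column). Contamination rules: a cell $u=(i,j)\in V_{n,m}$ can be contaminated by two contaminated cells $v,w\in V_{n,m}$ if one of the following holds: (a) $v=(i-1,j-1)$, $w=(i+1,j+1)$; (b) $v=(i+1,j-1)$, $w=(i-1,j+1)$; (c) $v=(i-1,j)$, $w=(i+1,j)$; (d) $v=(i,j-1)$, $w=(i,j+1)$; (e) $v=(i,j-1)$, $w=(i-1,j)$; (f) $v=(i,j-1)$, $w=(i+1,j)$; (g) $v=(i+1,j)$, $w=(i,j+1)$; (h) $v=(i-1,j)$, $w=(i,j+1)$. For $S\subseteq V_{n,m}$, the final contaminated set $C(S)$ is the smallest subset of $V_{n,m}$ containing $S$ and closed under rules (a)--(h). $S$ is a contaminating set if $C(S)=V_{n,m}$. The power contamination number $\gamma_c(G(n,m))$ is the minimum cardinality of a contaminating set; a contaminating set of this cardinality is an optimal solution. $\alpha_{n,m}$ denotes the number of optimal solutions of $G(n,m)$. The OEIS sequence A036289 is $k\mapsto k2^k$. *)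

(* Defs.v *)
(* MathComp world. *)
From mathcomp Require Import all_boot.

Set Implicit Arguments.
Unset Strict Implicit.
Unset Printing Implicit Defensive.

Definition cell (n m : nat) : finType := ('I_n * 'I_m)%type.

(* Coordinates start at 1, as 1 <= i <= n and 1 <= j <= m; hence the truncated
   subtractions i - 1 and j - 1 below are exact, and a coordinate equal to 0
   is that of no cell. *)
Definition pos (n m : nat) (u : cell n m) : nat * nat := (u.1.+1, u.2.+1).

(* The eight disjuncts are the rules (a) to (h), in this order. *)
Definition contaminates (n m : nat) (v w u : cell n m) : bool :=
  let: (i, j) := pos u in
  [|| (pos v == (i - 1, j - 1)) && (pos w == (i + 1, j + 1)),
      (pos v == (i + 1, j - 1)) && (pos w == (i - 1, j + 1)),
      (pos v == (i - 1, j)) && (pos w == (i + 1, j)),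
      (pos v == (i, j - 1)) && (pos w == (i, j + 1)),
      (pos v == (i, j - 1)) && (pos w == (i - 1, j)),
      (pos v == (i, j - 1)) && (pos w == (i + 1, j)),
      (pos v == (i + 1, j)) && (pos w == (i, j + 1))
    | (pos v == (i - 1, j)) && (pos w == (i, j + 1))].

Definition rule_closed (n m : nat) (X : {set cell n m}) : bool :=
  [forall v in X, forall w in X, forall u, contaminates v w u ==> (u \in X)].

(* Closed sets are stable under intersection, so this intersection is the
   smallest closed set that contains S. *)
Definition contaminated_set (n m : nat) (S : {set cell n m}) : {set cell n m} :=
  \bigcap_(X : {set cell n m} | (S \subset X) && rule_closed X) X.

Definition contaminating (n m : nat) (S : {set cell n m}) : bool :=
  contaminated_set S == [set: cell n m].

(* The starting point setT of arg min is itself a contaminating set. *)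
Definition gamma_c (n m : nat) : nat :=
  #|[arg min_(S < [set: cell n m] | contaminating S) #|S| ]|.

Definition optimal (n m : nat) (S : {set cell n m}) : bool :=
  contaminating S && (#|S| == gamma_c n m).

Definition alpha (n m : nat) : nat := #|[set S : {set cell n m} | optimal S]|.

(* Main.v *)
(* In two rows only two rules matter: two cells of a row at distance two fill
   the cell between them, and two diagonal neighbours fill their 2 x 2 square.
   Hence in a contaminating set the first and the last column are occupied and
   no two consecutive columns are empty, so at least k + 1 of the 2k columns
   are occupied. With exactly k + 1 cells, cut the columns into k blocks of two:
   there is a block p such that the blocks up to p have a cell in their left
   column and the blocks from p on have one in their right column. The two cells
   of block p must be diagonal neighbours, as otherwise nothing but gaps within
   a row gets filled; if they are, block p fills up and spreads in both
   directions. This leaves k choices of p and one free row per block. *)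
Require Import Defs.
From mathcomp Require Import all_boot.
From mathcomp Require Import zify.

Set Implicit Arguments.
Unset Strict Implicit.
Unset Printing Implicit Defensive.

(** * Closed sets in an arbitrary grid *)

Section ClosedSets.

Variables (n m : nat).
Implicit Types (X S : {set cell n m}).

Lemma contaminatingP S :
  reflect (forall X, rule_closed X -> S \subset X -> X = [set: cell n m])
          (contaminating S).
Proof.
apply: (iffP eqP) => [CS X clX SX|full].
  apply/eqP; rewrite -subTset -CS.
  by apply: bigcap_inf; rewrite SX.
apply/eqP; rewrite -subTset; apply/bigcapsP => X /andP[SX clX].
by rewrite (full X).
Qed.

Lemma rule_closedP X :
  reflect (forall v w u, v \in X -> w \in X -> contaminates v w u -> u \in X)
          (rule_closed X).
Proof.
apply: (iffP 'forall_in_forall_inP) => [H v w u vX wX|H v vX w wX].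
  by have /forallP/(_ u)/implyP := H v vX w wX.
by apply/forallP=> u; apply/implyP; apply: H.
Qed.

Lemma card_columns S : #|S| = \sum_(j < m) #|[set r | (r, j) \in S]|.
Proof.
rewrite -sum1_card (partition_big snd xpredT) //=.
apply: eq_bigr => j _; rewrite sum1dep_card.
rewrite -(card_imset [set r | (r, j) \in S] (f := fun r => (r, j))); last by move=> a b [].
apply: eq_card => -[r i]; rewrite !inE /=.
apply/andP/imsetP => [[rS /eqP <-]|[r' + [-> ->]]]; first by exists r; rewrite ?inE.
by rewrite inE.
Qed.

End ClosedSets.

Lemma ord2_neq (r s : 'I_2) : r != s -> r = rev_ord s.
Proof.
move=> rs; apply: ord_inj => /=; have : r != s :> nat by [].
by have [? ?] := (ltn_ord r, ltn_ord s); lia.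
Qed.

(** * Closure and obstructions to contamination in two rows *)

Section TwoRows.

Variable m : nat.
Implicit Types (X S : {set cell 2 m}) (r : 'I_2) (i j l : 'I_m).

Definition horizontal_closed X :=
  forall r i j l, j = i.+1 :> nat -> l = j.+1 :> nat ->
    (r, i) \in X -> (r, l) \in X -> (r, j) \in X.

Definition diagonal_closed X :=
  forall r s i j, r != s -> j = i.+1 :> nat ->
    (r, i) \in X -> (s, j) \in X -> ((r, j) \in X) && ((s, i) \in X).

(** Rules (a) to (c) need three distinct rows. Rule (d) is the horizontal condition, and in (e) to
    (h) the cells [v] and [w] are diagonal neighbours. *)
Lemma closed_two_rowsP X :
  reflect (horizontal_closed X /\ diagonal_closed X) (rule_closed X).
Proof.
apply: (iffP (rule_closedP X)) => [H|[hor dia] [a i] [b l] [c j] vX wX].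
  split=> [r i j l ij jl rX|r s i j rs ij rX sX].
    move=> lX; apply: H rX lX _; rewrite /contaminates /pos /=.
    by apply/orP; right; rewrite !xpair_eqE; lia.
  have /= ? : r != s :> nat by [].
  have [? ?] := (ltn_ord r, ltn_ord s).
  apply/andP; split; [apply: (H (r, i) (s, j))|apply: (H (r, i) (s, j))] => //;
  rewrite /contaminates /pos /= !xpair_eqE; lia.
rewrite /contaminates /pos /= !xpair_eqE => C.
have [? ? ?] := And3 (ltn_ord a) (ltn_ord b) (ltn_ord c).
have [[ac [bc [ij jl]]]|[[ab [ca [cj il]]]|[ab [cb [ci il]]]]] :
    (a = c :> nat /\ b = c :> nat /\ j = i.+1 :> nat /\ l = j.+1 :> nat)
    \/ (a <> b :> nat /\ c = a :> nat /\ j = l :> nat /\ l = i.+1 :> nat)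
    \/ (a <> b :> nat /\ c = b :> nat /\ j = i :> nat /\ l = i.+1 :> nat).
  by move: C; do 7?[case/orP]; lia.
- apply: hor ij jl _ _; first by rewrite -(ord_inj ac).
  by rewrite -(ord_inj bc).
- rewrite (ord_inj ca) (ord_inj cj).
  by have /andP[] // := dia _ _ _ _ (introN eqP ab) il vX wX.
- rewrite (ord_inj cb) (ord_inj ci).
  by have /andP[] // := dia _ _ _ _ (introN eqP ab) il vX wX.
Qed.

Definition full_column X j := forall r, (r, j) \in X.

Lemma full_adjacent X r i j : rule_closed X ->
  (j = i.+1 :> nat) \/ (i = j.+1 :> nat) ->
  full_column X i -> (r, j) \in X -> full_column X j.
Proof.
move=> /closed_two_rowsP[_ dia] ij fi rX s.
have [<-//|rs] := eqVneq r s.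
case: ij => ij; first by have /andP[] := dia s r i j (contra_neq esym rs) ij (fi s) rX.
by have /andP[] := dia r s j i rs ij rX (fi s).
Qed.

(** Row [r] fills across column [j] first; fullness then passes from [i] to [j] and from [j] to
    [l]. *)
Lemma full_skip X r i j l : rule_closed X ->
    (j = i.+1 :> nat /\ l = j.+1 :> nat) \/ (i = j.+1 :> nat /\ j = l.+1 :> nat) ->
    full_column X i -> (r, l) \in X ->
  full_column X j /\ full_column X l.
Proof.
move=> clX ijl fi rX; have /closed_two_rowsP[hor _] := clX.
have rj : (r, j) \in X.
  by case: ijl => -[ij jl]; [apply: hor ij jl (fi r) rX|apply: hor jl ij rX (fi r)].
have fj : full_column X j by apply: (full_adjacent clX _ fi rj); lia.
by split=> //; apply: (full_adjacent clX _ fj rX); lia.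
Qed.

(* Columns [t.-1] and [t] are removed; for [t = 0] and [t = m] only one of them
   exists, which gives the first and the last column. *)
Lemma closed_gap t :
  rule_closed [set u : cell 2 m | (u.2.+1 != t) && (u.2 != t :> nat)].
Proof.
apply/closed_two_rowsP; split=> [r i j l|r s i j _] ij; rewrite !inE /=; lia.
Qed.

(* [g] labels the boundaries between columns with rows; a cell survives when both
   of its boundaries carry its row, so no two surviving cells are diagonal
   neighbours. *)
Lemma closed_track (g : nat -> 'I_2) :
  rule_closed [set u : cell 2 m | (g u.2 == u.1) && (g u.2.+1 == u.1)].
Proof.
apply/closed_two_rowsP; split=> [r i j l ij jl|r s i j rs ij]; rewrite !inE /=.
  by rewrite jl ij => /andP[_ ->] /andP[->].
by rewrite ij => /andP[_ /eqP->] /andP[/eqP rs']; rewrite rs' eqxx in rs.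
Qed.

Lemma contaminating_gap S t : contaminating S -> 0 < m -> t <= m ->
  exists2 u, u \in S & (u.2.+1 == t) || (u.2 == t :> nat).
Proof.
move=> /contaminatingP cS m0 tm; apply/exists_inP; apply: contraT.
rewrite negb_exists_in => /forall_inP gapS.
have /setP gapT := cS _ (closed_gap t) ltac:(by apply/subsetP => u /gapS; rewrite inE negb_or).
(* The missing cell is taken in column [t], or in the last column when [t = m]. *)
have tm' : minn t m.-1 < m by lia.
have := gapT (ord0, Ordinal tm'); rewrite !inE /=; lia.
Qed.

Lemma contaminating_track S (g : nat -> 'I_2) : contaminating S -> 0 < m ->
  exists2 u, u \in S & (g u.2 != u.1) || (g u.2.+1 != u.1).
Proof.
move=> /contaminatingP cS m0; apply/exists_inP; apply: contraT.
rewrite negb_exists_in => /forall_inP trackS.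
have /setP trackT := cS _ (closed_track g)
  ltac:(by apply/subsetP => u /trackS; rewrite inE negb_or !negbK).
(* In the first column, the cell outside row [g 0] does not survive. *)
have := trackT (rev_ord (g 0), Ordinal m0); rewrite !inE /= => /andP[/eqP/(congr1 val)/=].
have := ltn_ord (g 0); lia.
Qed.

(* [j] ranges over nat so that neighbours such as [hit S j.+1] need no bound. *)
Definition hit S (j : nat) r := [exists i : 'I_m, (i == j :> nat) && ((r, i) \in S)].

Lemma hitE S r i : hit S i r = ((r, i) \in S).
Proof.
apply/existsP/idP => [[l /andP[/eqP/ord_inj->]]//|rS].
by exists i; rewrite eqxx.
Qed.

Lemma card_hit S : #|S| = \sum_(j < m) #|hit S j|.
Proof.
rewrite card_columns; apply: eq_bigr => j _.
by apply: eq_card => r; rewrite inE -hitE.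
Qed.

Lemma contaminating_hits S : contaminating S -> 0 < m ->
  [/\ 0 < #|hit S 0|, 0 < #|hit S m.-1|
    & forall t, t.+1 < m -> 0 < #|hit S t| + #|hit S t.+1|].
Proof.
move=> cS m0.
have hit_gt0 u t : u \in S -> (u.2 == t :> nat) -> 0 < #|hit S t|.
  by case: u => r i rS /eqP <-; apply/card_gt0P; exists r; rewrite -hitE in rS.
split=> [||t tm].
- by have [u uS u0] := contaminating_gap cS m0 (leq0n m); apply: hit_gt0 uS u0.
- have [u uS um] := contaminating_gap cS m0 (leqnn m).
  by apply: hit_gt0 uS _; have := ltn_ord u.2; lia.
- have [u uS uj] := contaminating_gap cS m0 (ltnW tm).
  rewrite addn_gt0; apply/orP.
  by case/orP: uj => [uj|uj]; [left|right]; apply: hit_gt0 uS _; lia.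
Qed.

End TwoRows.

(* The selected columns are the even ones up to [p.*2] and the odd ones after. *)
Lemma column_counts (k : nat) (c : nat -> nat) :
    0 < c 0 -> (forall j, j.+1 < k.*2 -> 0 < c j + c j.+1) ->
  [/\ k <= \sum_(j < k.*2) c j,
      \sum_(j < k.*2) c j = k -> forall j, j < k.*2 -> c j = ~~ odd j
    & \sum_(j < k.*2) c j = k.+1 -> 0 < c k.*2.-1 ->
      exists2 p, p < k & forall j, j < k.*2 -> c j = (odd j == (p.*2 < j))].
Proof.
move=> c0; elim: k => [|k IHk] cS; first by rewrite big_ord0; split.
have [|le_k eq_k eq_k1] := IHk; first by move=> j jk; apply: cS; lia.
rewrite doubleS !big_ord_recr /=; set s := \sum_(i < _) _ in le_k eq_k eq_k1 *.
have ck := cS k.*2 ltac:(lia).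
(* With sum [k], the odd column just before [k.*2] is empty. *)
have s_k : s = k -> 0 < c k.*2.
  move=> sk; case: (posnP k) => [->//|k0].
  have := cS k.*2.-1; rewrite (eq_k sk) prednK; try lia.
have lastP (P : nat -> Prop) :
    (forall j, j < k.*2 -> P j) -> P k.*2 -> P k.*2.+1 -> forall j, j < k.*2.+2 -> P j.
  move=> Pk P0 P1 j; rewrite !ltnS leq_eqVlt => /orP[/eqP->//|].
  by rewrite ltnS leq_eqVlt => /orP[/eqP->//|/Pk].
split=> [|sum|sum c1]; first lia.
- have sk : s = k by lia.
  have := s_k sk => ?.
  by apply: lastP; [apply: eq_k | lia | lia].
(* Here the new block has count two and is itself block [p]. *)
- have [sk|sk] := eqVneq s k.
    have := s_k sk => ?.
    exists k => //; apply: lastP => [j jk||]; [rewrite eq_k //|..]; lia.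
  (* Now the new block has count one, in its right column by [c1]. Its empty left column makes
     column [k.*2.-1] occupied, as the induction hypothesis requires. *)
  have k0 : 0 < k.
    rewrite lt0n; apply/eqP => k0; move: sk sum; rewrite /s k0 big_ord0; lia.
  have := cS k.*2.-1; rewrite prednK ?double_gt0 // => ck1.
  have [||p pk cp] := eq_k1; try lia.
  by exists p; first lia; apply: lastP => //; lia.
Qed.

(** * The minimal sets for even width and their number *)

Section EvenWidth.

Variable k : nat.
Implicit Types (S : {set cell 2 k.*2}) (p b : 'I_k) (f : {ffun 'I_k -> 'I_2}).

Lemma even_column_proof b : b.*2 < k.*2. Proof. by rewrite ltn_double. Qed.
Lemma odd_column_proof b : b.*2.+1 < k.*2.
Proof. by rewrite ltn_Sdouble. Qed.

Definition even_column b : 'I_k.*2 := Ordinal (even_column_proof b).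
Definition odd_column b : 'I_k.*2 := Ordinal (odd_column_proof b).

Definition block_cell p f b : cell 2 k.*2 :=
  (f b, if b <= p then even_column b else odd_column b).

(** The extra cell takes the row opposite to [f p], which makes the two cells of block [p] diagonal
    neighbours. *)
Definition block_set p f : {set cell 2 k.*2} :=
  (rev_ord (f p), odd_column p) |: [set block_cell p f b | b : 'I_k].

Lemma block_cell_in p f b : block_cell p f b \in block_set p f.
Proof. by rewrite !inE imset_f ?orbT. Qed.

Lemma block_set_contaminating p f : contaminating (block_set p f).
Proof.
apply/contaminatingP => X clX /subsetP sX.
have bX b : block_cell p f b \in X by apply/sX/block_cell_in.
have pX : (rev_ord (f p), odd_column p) \in X by apply: sX; rewrite !inE eqxx.
have fullp : full_column X (even_column p) /\ full_column X (odd_column p).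
  have /closed_two_rowsP[_ dia] := clX.
  have := bX p; rewrite /block_cell leqnn => pX'.
  have rp : f p != rev_ord (f p).
    apply/eqP => /(congr1 val) /=; have := ltn_ord (f p); lia.
  have /andP[X1 X2] := dia _ _ (even_column p) (odd_column p) rp erefl pX' pX.
  by split=> r; have [->//|/ord2_neq->] := eqVneq r (f p).
have fullr d b : b = p + d :> nat ->
    full_column X (even_column b) /\ full_column X (odd_column b).
  elim: d b => [|d IHd] b bpd; first by rewrite (_ : b = p) //; apply: ord_inj; lia.
  have b'k : p + d < k by have := ltn_ord b; lia.
  have [_ fb'] := IHd (Ordinal b'k) erefl.
  have := bX b; rewrite /block_cell ifN; last lia.
  by apply: full_skip fb' => //=; lia.
have fulll d b : p = b + d :> nat ->
    full_column X (even_column b) /\ full_column X (odd_column b).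
  elim: d b => [|d IHd] b bpd; first by rewrite (_ : b = p) //; apply: ord_inj; lia.
  have b'k : b.+1 < k by have := ltn_ord p; lia.
  have [fb' _] := IHd (Ordinal b'k) ltac:(move=> /=; lia).
  have := bX b; rewrite /block_cell ifT; last lia.
  by move=> rX; apply/and_comm; apply: full_skip fb' rX => //=; lia.
apply/setP => -[r j]; rewrite inE.
have jk : j./2 < k by have := ltn_ord j; lia.
have [fe fo] : full_column X (even_column (Ordinal jk)) /\ full_column X (odd_column (Ordinal jk)).
  case: (leqP p j./2) => pj; first by apply: (fullr (j./2 - p)) => /=; lia.
  by apply: (fulll (p - j./2)) => /=; lia.
have [oj|oj] := boolP (odd j).
  have -> : j = odd_column (Ordinal jk) by apply: ord_inj => /=; lia.
  exact: fo.
have -> : j = even_column (Ordinal jk) by apply: ord_inj => /=; lia.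
exact: fe.
Qed.

(** The first block with an occupied right column is [p]; then [f] is read off the block cells, none
    of which shares a column with the extra cell. *)
Lemma block_set_inj : injective (fun pf => block_set pf.1 pf.2).
Proof.
have le_p p f q h : block_set p f \subset block_set q h -> q <= p.
  move=> /subsetP/(_ (rev_ord (f p), odd_column p)); rewrite !inE eqxx => /(_ isT).
  case/orP => [/eqP[_ pq]|/imsetP[b _ [_]]]; first lia.
  by case: ifP => bq /(congr1 val) /=; lia.
move=> [p f] [q h] /= E.
have pq : p = q.
  apply: ord_inj; apply/eqP; rewrite eqn_leq.
  by rewrite (le_p p f q h) ?(le_p q h p f) ?E.
rewrite -{q}pq in E *; congr pair; apply/ffunP => b.
have := block_cell_in p f b; rewrite E !inE.
case/orP => [/eqP[_]|/imsetP[b' _ [-> col]]].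
  by case: ifP => bp /(congr1 val) /=; lia.
congr (h _); apply: ord_inj; move: col.
by do 2?case: ifP => ?; move/(congr1 val) => /=; lia.
Qed.

Lemma contaminating_counts S : 0 < k -> contaminating S ->
  k < #|S| /\
  (#|S| = k.+1 -> exists p, forall j, j < k.*2 -> #|hit S j| = (odd j == (p.*2 < j))).
Proof.
move=> k0 cS; have [|c0 c1 cS2] := contaminating_hits cS; first by rewrite double_gt0.
have [le_k eq_k eq_k1] := column_counts c0 cS2.
rewrite card_hit; split; last first.
  by move=> /eq_k1[//|p pk E]; exists (Ordinal pk).
(* A total of [k] would leave the last column, an odd one, empty. *)
rewrite ltn_neqAle le_k andbT; apply/eqP => /esym/eq_k/(_ k.*2.-1).
lia.
Qed.

(** The lower bound comes from contamination, so distinctness of the listed cells need not be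
    checked. *)
Lemma card_block_set p f : #|block_set p f| = k.+1.
Proof.
have k0 : 0 < k by case: (k) p => [[]|].
apply/eqP; rewrite eqn_leq (contaminating_counts k0 (block_set_contaminating p f)).1 andbT.
by rewrite cardsU1; apply: leq_add (leq_b1 _) _; rewrite -[leqRHS]card_ord leq_imset_card.
Qed.

Lemma minimal_block_set S : 0 < k -> contaminating S -> #|S| = k.+1 ->
  exists p f, S = block_set p f.
Proof.
move=> k0 cS Sk; have [_ /(_ Sk)[p hitS]] := contaminating_counts k0 cS.
(* The default [ord0] occurs only at columns without a cell of [S]. *)
pose row j := odflt ord0 [pick r | hit S j r].
have hit_row j : j < k.*2 -> odd j == (p.*2 < j) -> hit S j (row j).
  move=> jk sel_j; rewrite /row; case: pickP => //= none.
  by have := hitS j jk; rewrite sel_j eq_card0.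
have in_row r i : (r, i) \in S -> odd i == (p.*2 < i) /\ r = row i.
  rewrite -hitE => hr; have : 0 < #|hit S i| by apply/card_gt0P; exists r.
  rewrite hitS // lt0b => sel_i; split=> //.
  have /card_le1_eqP eq1 : #|hit S i| <= 1 by rewrite hitS // leq_b1.
  by apply: eq1 => //; apply: hit_row.
have rowS (i : 'I_k.*2) : odd i == (p.*2 < i) -> (row i, i) \in S.
  by move=> sel_i; rewrite -hitE; apply: hit_row.
have row_p : row p.*2.+1 != row p.*2.
  apply: contraT; rewrite negbK => /eqP row_p.
  (* Each occupied column passes its row to both of its boundaries. A conflict could arise only
     between the adjacent occupied columns [p.*2] and [p.*2.+1], whose rows agree here. *)
  pose g j := if odd j == (p.*2 < j) then row j else row j.-1.
  have [|[r i] /in_row[sel_i ->]] := contaminating_track g cS; first by rewrite double_gt0.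
  rewrite /g /= sel_i eqxx /=; case: ifP => sel_i1; last by rewrite eqxx.
  by rewrite (_ : nat_of_ord i = p.*2) ?row_p ?eqxx //; lia.
exists p, [ffun b : 'I_k => row (if b <= p then even_column b else odd_column b)].
apply/esym/eqP; rewrite eqEcard Sk card_block_set leqnn andbT subUset sub1set.
apply/andP; split.
  rewrite ffunE leqnn /= -(ord2_neq row_p) (rowS (odd_column p)) //=; lia.
apply/subsetP => _ /imsetP[b _ ->]; rewrite /block_cell ffunE.
by apply: rowS; case: ifP => /=; lia.
Qed.

Lemma gamma_c_even : 0 < k -> gamma_c 2 k.*2 = k.+1.
Proof.
move=> k0; rewrite /gamma_c; case: arg_minnP => [|S cS minS].
  by apply/contaminatingP => X _; rewrite subTset => /eqP.
apply/eqP; rewrite eqn_leq (contaminating_counts k0 cS).1 andbT.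
rewrite -(card_block_set (Ordinal k0) [ffun=> ord0]).
exact/minS/block_set_contaminating.
Qed.

Lemma alpha_even : 0 < k -> alpha 2 k.*2 = k * 2 ^ k.
Proof.
move=> k0.
rewrite -[RHS](_ : #|{: 'I_k * {ffun 'I_k -> 'I_2}}| = _); last first.
  by rewrite card_prod card_ffun !card_ord.
rewrite -(card_imset _ block_set_inj); apply: eq_card => S.
rewrite inE /optimal gamma_c_even //; apply/andP/imsetP => [[cS /eqP Sk]|[[p f] _ ->]].
  by have [p [f ->]] := minimal_block_set k0 cS Sk; exists (p, f).
by rewrite block_set_contaminating card_block_set.
Qed.

End EvenWidth.

Theorem proposition6 (k : nat) (hk : 1 <= k) : alpha 2 (2 * k) = k * 2 ^ k.
Proof. by rewrite mul2n alpha_even. Qed.
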